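(* Suppose that $\kappa < \mu$ are infinite cardinals such that $\mathrm{cf}(\mu) < \kappa$ and there does not exist a strongly unbounded subadditive coloring $c:(\mathscr{P}_\kappa \mu^+)^{[2]} \rightarrow \mathrm{cf}(\mu)$. Then $\mathsf{CP}(\mathcal D)$ holds for every uniform, transitive $\mathrm{cf}(\mu)$-covering matrix $\mathcal D$ for $\mu^+$.
   Context: $\mathscr{P}_\kappa X = \{x \subseteq X \mid |x|<\kappa\}$, viewed as a partial order under $\subsetneq$; $(\mathscr{P}_\kappa X)^{[2]}$ is the set of pairs $(x,y)$ of elements of $\mathscr{P}_\kappa X$ with $x \subsetneq y$. For a partial order $\Lambda$ and $\Lambda^{[2]}$ its set of pairs $(u,v)$ with $u<_\Lambda v$, a function $c:\Lambda^{[2]} \to \theta$ is subadditive if for all $u <_\Lambda v <_\Lambda w$: $c(u,w) \leq \max\{c(u,v), c(v,w)\}$ and $c(u,v) \leq \max\{c(u,w), c(v,w)\}$; strongly unbounded if for every cofinal $\Gamma \subseteq \Lambda$, $c``\Gamma^{[2]}$ is unbounded in $\theta$. For regular cardinals $\theta < \lambda$, a $\theta$-covering matrix for $\lambda$ is $\mathcal D = \langle D(i,\beta) \mid i < \theta, \beta < \lambda\rangle$ such that (1) for each $\beta<\lambda$, $\langle D(i,\beta) \mid i < \theta\rangle$ is $\subseteq$-increasing with union $\beta$; (2) for all $\beta < \gamma < \lambda$ and $i < \theta$ there is $j < \theta$ with $D(i,\beta) \subseteq D(j,\gamma)$. $\mathcal D$ is transitive if for all $\beta < \gamma<\lambda$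 and $i<\theta$, $\beta \in D(i,\gamma)$ implies $D(i,\beta) \subseteq D(i,\gamma)$; uniform if for every limit $\beta < \lambda$ there is $i<\theta$ such that $D(i,\beta)$ contains a club in $\beta$. $\mathsf{CP}(\mathcal D)$ holds if there is an unbounded $A \subseteq \lambda$ such that for every $X \in [A]^\theta$ there are $\beta<\lambda$ and $i<\theta$ with $X \subseteq D(i,\beta)$. *)

(* Defs.v *)
From HB Require Import structures.
From mathcomp Require Import all_boot all_order.
From mathcomp Require Import boolp classical_sets functions cardinality.

Set Implicit Arguments.
Unset Strict Implicit.
Unset Printing Implicit Defensive.

Import Order.TTheory.
Local Open Scope classical_set_scope.
Local Open Scope order_scope.
Local Open Scope card_scope.

Reserved Notation "A '#<' B" (at level 79, format "A  '#<'  B").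

Definition card_lt T U (A : set T) (B : set U) : bool :=
  (A #<= B) && ~~ (A #= B).
Notation "A '#<' B" := (card_lt A B) : card_scope.

(* In a limit ordinal, being cofinal is the same as being unbounded. *)
Definition cofinal d (P : porderType d) (A : set P) : Prop :=
  forall x, exists2 y, A y & x <= y.

(* An ordinal is represented by a well-ordered type: its elements are the
   smaller ordinals, and the element b is, as a set, [set a | a < b]. *)
Definition is_ordinal d (T : orderType d) : Prop :=
  well_founded (fun x y : T => x < y).

(* Cardinals are initial ordinals. *)
Definition is_cardinal d (T : orderType d) : Prop :=
  is_ordinal T /\ forall b : T, [set a | a < b] #< [set: T].

Definition is_infinite_cardinal d (T : orderType d) : Prop :=
  is_cardinal T /\ infinite_set [set: T].

(* L = M^+ *)
Definition is_successor_cardinal dL (L : orderType dL) dM (M : orderType dM) :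
    Prop :=
  [/\ is_cardinal L, [set: M] #< [set: L] &
      forall (U : Type) (B : set U), [set: M] #< B -> [set: L] #<= B].

(* T = cf(M), the least cardinality of a cofinal subset of M *)
Definition is_cofinality dT (T : orderType dT) dM (M : orderType dM) : Prop :=
  [/\ is_cardinal T,
      exists2 A : set M, cofinal A & A #= [set: T] &
      forall A : set M, cofinal A -> [set: T] #<= A].

Section Colorings.
Context d (P : porderType d) dT (T : orderType dT).

Definition pairs : Type := {p : P * P | p.1 < p.2}.

Definition mkpair (u v : P) (uv : u < v) : pairs := exist _ (u, v) uv.

Definition subadditive (c : pairs -> T) : Prop :=
  forall (u v w : P) (uv : u < v) (vw : v < w) (uw : u < w),
    c (mkpair uw) <= Order.max (c (mkpair uv)) (c (mkpair vw)) /\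
    c (mkpair uv) <= Order.max (c (mkpair uw)) (c (mkpair vw)).

Definition strongly_unbounded (c : pairs -> T) : Prop :=
  forall G : set P, cofinal G ->
    cofinal (c @` [set p | G (val p).1 /\ G (val p).2]).

End Colorings.

(* The order is inherited from set X, hence < is strict inclusion, see
   lt_PkappaE. *)
Definition Pkappa (K X : Type) : Type :=
  {x : set X | x \in [set y : set X | y #< [set: K]]}.

HB.instance Definition _ (K X : Type) := SubChoice.on (Pkappa K X).
HB.instance Definition _ (K X : Type) :=
  [SubChoice_isSubPOrder of Pkappa K X by <: with set_display].

Lemma lt_PkappaE (K X : Type) (x y : Pkappa K X) :
  (x < y) = (val x `<` val y) :> Prop.
Proof. by rewrite -properEset. Qed.

Section Clubs.
Context d (L : orderType d).

Definition is_limit (b : L) : Prop :=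
  (exists a, a < b) /\ forall a, a < b -> exists2 g, a < g & g < b.

Definition unbounded_below (C : set L) (b : L) : Prop :=
  forall a, a < b -> exists2 g, C g & a <= g /\ g < b.

Definition club_in (C : set L) (b : L) : Prop :=
  [/\ C `<=` [set a | a < b],
      unbounded_below C b &
      forall a, a < b -> is_limit a -> unbounded_below C a -> C a].

End Clubs.

Section CoveringMatrices.
Context dT (T : orderType dT) dL (L : orderType dL).
Implicit Type D : T -> L -> set L.

Definition covering_matrix D : Prop :=
  [/\ forall b i j, i <= j -> D i b `<=` D j b,
      forall b, \bigcup_i D i b = [set a | a < b] &
      forall b g i, b < g -> exists j, D i b `<=` D j g].

Definition transitive_matrix D : Prop :=
  forall b g i, b < g -> D i g b -> D i b `<=` D i g.

Definition uniform_matrix D : Prop :=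
  forall b, is_limit b ->
    exists i, exists2 C : set L, club_in C b & C `<=` D i b.

Definition CP D : Prop :=
  exists2 A : set L, cofinal A &
    forall X : set L, X `<=` A -> X #= [set: T] ->
      exists b i, X `<=` D i b.

End CoveringMatrices.

(* Main.v *)
Require Import Defs.
From HB Require Import structures.
From mathcomp Require Import all_boot all_order wochoice.
From mathcomp Require Import boolp classical_sets functions cardinality.

(**
  For x in P_kappa(mu^+), write F_b(j) = D(j, b) `&` x. By transitivity F_b is
  included in F_g for b < g at all large j. If for every x this sequence is
  constant from some b_x on, up to initial segments of cf(mu), then the least i
  such that F_{b_x} and F_{b_y} agree on x at all j >= i is a subadditive
  coloring c(x, y), hence by assumption bounded, by i say, on a cofinal family
  G. Choose x_a in G containing a, and j_a >= i with a in D(j_a, b_{x_a}). As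
  cf(mu) < mu^+, some j equals j_a for cofinally many a, and these a witness
  CP(D), because G is directed.

  Stabilization is an argument of Shelah, with uniformity as its key input.
  Since mu is a limit cardinal, N = kappa^+, I = kappa^{++} and R = kappa^{+3}
  lie below mu. If some sequence of traces did not stabilize, build a strictly
  growing R-sequence of traces each term of which dominates, whenever some trace
  does, the union of the earlier terms along any initial segment of any member
  of a club-guessing family of N-sequences in R. At the supremum delta of this
  sequence a club lies in a single D(i, delta), so some guessed N-sequence
  consists of traces included in F_delta from i on. Hence its unions are
  dominated along the sequence; but they stop growing, because N is larger than
  x and cf(mu), which contradicts the strict growth.
*)

Set Implicit Arguments.
Unset Strict Implicit.
Unset Printing Implicit Defensive.

Import Order.TTheory.
Local Open Scope order_scope.
Local Open Scope classical_set_scope.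
Local Open Scope card_scope.

(** * Well-orders *)

Lemma ordinal_least d (W : orderType d) (A : set W) :
  is_ordinal W -> A !=set0 -> exists2 m, A m & forall a, A a -> m <= a.
Proof.
move=> wfW [a Aa]; elim/(well_founded_ind wfW): a Aa => a IH Aa.
have [[b [ba Ab]]|nb] := pselect (exists b, b < a /\ A b); first exact: IH Ab.
by exists a => // b Ab; rewrite leNgt; apply/negP => ba; apply: nb; exists b.
Qed.

Lemma ordinal_choice_recursion d (W : orderType d) (V : Type) (v0 : V)
    (P : W -> (W -> V) -> V -> Prop) :
  is_ordinal W ->
  (forall s f g v, (forall t, t < s -> f t = g t) -> P s f v -> P s g v) ->
  (forall s f, (forall t, t < s -> P t f (f t)) -> exists v, P s f v) ->
  exists f, forall s, P s f (f s).
Proof.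
move=> wfW localP exP.
pose extend (s : W) (g : forall t, t < s -> V) t :=
  if pselect (t < s) is left ts then g t ts else v0.
have /choice[next nextP] : forall sf : W * (W -> V),
    exists v, (exists w, P sf.1 sf.2 w) -> P sf.1 sf.2 v.
  move=> [s f]; have [[v Pv]|nv] := pselect (exists w, P s f w);
    by [exists v|exists v0].
pose step s g := next (s, extend s g).
pose f := Fix wfW (fun _ => V) step.
have fE s : f s = step s (fun t _ => f t).
  rewrite /f Fix_eq // => t g h gh; congr step.
  by apply: functional_extensionality_dep => u;
     apply: functional_extensionality_dep => ut.
exists f => s; elim/(well_founded_ind wfW): s => s IH.
have extendE t : t < s -> f t = extend s (fun t _ => f t) t.
  by rewrite /extend; case: pselect.
have [v Pv] := exP s f IH.
apply: (localP _ (extend s (fun t _ => f t))) => [t /extendE//|].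
rewrite fE; apply: (nextP (s, _)).
by exists v; apply: localP Pv => t; apply: extendE.
Qed.

Lemma well_orderable (T : Type) :
  exists d (W : orderType d) (f : T -> W), is_ordinal W /\ injective f.
Proof.
have [R woR] := well_ordering_principle {classic T}.
have wochR : wo_chain R predT by move=> C _; exact: woR.
have totR : total R by move=> x y; exact: (wo_chainW wochR).
have antiR : antisymmetric R.
  by move=> x y; exact: (wo_chain_antisymmetric wochR).
have transR : transitive R.
  move=> y x z Rxy Ryz.
  have [|m [[]]] := woR [pred u | [|| u == x, u == y | u == z]].
    by exists x; rewrite inE eqxx.
  rewrite inE => /or3P[] /eqP-> + _ => minR.
  - by apply: minR; rewrite !inE eqxx !orbT.
  - by rewrite (antiR x y) // Rxy minR // inE eqxx.
  - by rewrite -(antiR y z) // Ryz minR // !inE eqxx orbT.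
pose ltR x y := (y != x) && R x y.
pose orderR := Order.isOrder.Build (Order.Disp tt tt) {classic T}
  (fun _ _ => erefl (ltR _ _)) (fun _ _ => erefl) (fun _ _ => erefl)
  antiR transR totR.
pose W : orderType _ := HB.pack {classic T} orderR.
exists _, W, (fun x => x); split; last by move=> x y.
move=> x; apply: contrapT => nAx.
have [|m [[nAm m_min] _]] := woR [pred u | ~~ `[< Acc <%O (u : W) >]].
  by exists x; rewrite inE; apply/asboolPn.
move: nAm; rewrite inE => /asboolPn; apply; constructor=> y ym.
apply: contrapT => /asboolPn nAy.
by move: ym; rewrite ltNge => /negP; apply; exact: m_min.
Qed.

Lemma lexi_ordinal d (V : orderType d) d' (W : orderType d') :
  is_ordinal V -> is_ordinal W -> is_ordinal (V *l W).
Proof.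
move=> wfV wfW [a b].
elim/(well_founded_ind wfV): a b => a IHa b.
elim/(well_founded_ind wfW): b => b IHb.
constructor=> -[a' b']; rewrite Order.ProdLexiOrder.ltEprodlexi /=.
move=> /andP[]; rewrite le_eqVlt => /orP[/eqP->|aa' _]; last exact: IHa.
by rewrite lexx => /IHb.
Qed.

(** * Cardinal arithmetic *)

Lemma set_inj_card_le T U (A : set T) (B : set U) (f : T -> U) :
  set_fun A B f -> set_inj A f -> A #<= B.
Proof.
move=> fAB f_inj; suff [g] : $|{injfun A >-> B}| by exact: inj_card_le.
by apply/injfunPex; exists f.
Qed.

Lemma sub_image_card_le T U (A : set T) (B : set U) (f : U -> T) :
  A `<=` f @` B -> A #<= B.
Proof.
by move=> /subset_card_le AfB; exact: card_le_trans AfB (card_image_le f B).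
Qed.

Lemma card_le_sub_image T U (A : set T) (B : set U) (t : T) :
  A #<= B -> exists f : U -> T, A `<=` f @` B.
Proof.
move=> /pfcard_geP[->|[f]]; first by exists (fun=> t).
by exists f; exact: 'surj_f.
Qed.

Lemma ordinal_card_le d (W : orderType d) (S : set W) U (B : set U) :
  is_ordinal W ->
  (forall w, S w -> ~ (B #<= S `&` [set a | a < w])) -> S #<= B.
Proof.
move=> wfW small.
have [->|/set0P[s0 Ss0]] := eqVneq S set0; first exact: card_ge0.
have [B0|/set0P[u _]] := eqVneq B set0.
  by case: (small s0 Ss0); rewrite B0; exact: card_ge0.
have [f fP] : exists f : W -> U, forall s, S s ->
    (B `\` f @` (S `&` [set t | t < s])) (f s).
  apply: (ordinal_choice_recursion u (P := fun s f v => S s ->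
    (B `\` f @` (S `&` [set t | t < s])) v)) => // [s f g v fg|s f _].
    suff -> : f @` (S `&` [set t | t < s]) = g @` (S `&` [set t | t < s]) by [].
    by apply: eq_imagel => t [_ /fg].
  have [Ss|nSs] := pselect (S s); last by exists u.
  apply: contrapT => none; apply/(small s Ss)/(sub_image_card_le (f := f)).
  by move=> b Bb; apply: contrapT => nb; apply: none; exists b.
apply: (set_inj_card_le (f := f)) => [a /fP[]//|a b]; rewrite !inE => Sa Sb fab.
case: (ltgtP a b) => // [ab|ba].
- by have [_ []] := fP b Sb; exists a.
- by have [_ []] := fP a Sa; exists b.
Qed.

Lemma card_le_total T U (A : set T) (B : set U) : (A #<= B) || (B #<= A).
Proof.
have [d [W [f [wfW f_inj]]]] := well_orderable T.
have fA : f @` A #= A by exact: inj_card_eq (in2W _).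
have [BA|/negP nBA] := boolP (B #<= A); first by rewrite orbT.
rewrite orbF -(card_le_eql fA).
apply: (ordinal_card_le wfW) => w _ Bw; apply: nBA.
rewrite -(card_le_eqr fA).
by apply: card_le_trans Bw (subset_card_le _) => a [].
Qed.

Lemma card_ltNge T U (A : set T) (B : set U) : (A #< B) = ~~ (B #<= A).
Proof.
rewrite /card_lt card_eq_le negb_and; case: (boolP (A #<= B)) => //= nAB.
by have := card_le_total A B; rewrite (negbTE nAB) /= => ->.
Qed.

Lemma card_leNgt T U (A : set T) (B : set U) : (A #<= B) = ~~ (B #< A).
Proof. by rewrite card_ltNge negbK. Qed.

Lemma card_ltW T U (A : set T) (B : set U) : A #< B -> A #<= B.
Proof. by case/andP. Qed.

Lemma card_le_lt_trans T U V (A : set T) (B : set U) (C : set V) :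
  A #<= B -> B #< C -> A #< C.
Proof.
by rewrite !card_ltNge => AB; apply: contra => CA; exact: card_le_trans CA AB.
Qed.

Lemma finite_card_le T U (A : set T) (B : set U) :
  finite_set A -> infinite_set B -> A #<= B.
Proof.
by move=> /finite_set_countable Afin /infiniteP; exact: card_le_trans.
Qed.

Lemma card_setX_le T1 T2 U1 U2 (A1 : set T1) (A2 : set T2) (B1 : set U1)
    (B2 : set U2) : A1 #<= B1 -> A2 #<= B2 -> A1 `*` A2 #<= B1 `*` B2.
Proof.
have [->|/set0P[a1 _]] := eqVneq A1 set0; first by rewrite set0X card_ge0.
have [->|/set0P[a2 _]] := eqVneq A2 set0; first by rewrite setX0 card_ge0.
move=> /(card_le_sub_image a1)[f1 f1A] /(card_le_sub_image a2)[f2 f2A].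
apply: (sub_image_card_le (f := fun p => (f1 p.1, f2 p.2))).
by move=> [x y] [/= /f1A[b1 ? <-] /f2A[b2 ? <-]]; exists (b1, b2).
Qed.

Lemma card_bigcup_square_le T I U (J : set I) (F : I -> set T) (B : set U) :
  J #<= B -> (forall i, J i -> F i #<= B) ->
  \bigcup_(i in J) F i #<= B `*` B.
Proof.
have [->|/set0P[t [i0 _ _]]] := eqVneq (\bigcup_(i in J) F i) set0.
  by move=> _ _; exact: card_ge0.
move=> /(card_le_sub_image i0)[h hJ] FB.
have /choice[f fF] : forall i, exists f : U -> T, J i -> F i `<=` f @` B.
  move=> i; have [Ji|nJi] := pselect (J i); last by exists (fun=> t).
  by have [f fF] := card_le_sub_image t (FB i Ji); exists f.
apply: (sub_image_card_le (f := fun p => f (h p.1) p.2)).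
move=> x [i Ji /(fF i Ji)[b2 Bb2 <-]].
by have [b1 Bb1 <-] := hJ i Ji; exists (b1, b2).
Qed.

Lemma card_setU_square_le T U (A B : set T) (C : set U) :
  infinite_set C -> A #<= C -> B #<= C -> A `|` B #<= C `*` C.
Proof.
move=> Cinf AC BC; rewrite -bigcup2inE.
apply: card_bigcup_square_le => [|[|[|i]] _]; rewrite //= ?card_ge0 //.
by apply: finite_card_le Cinf; exact: finite_II.
Qed.

Section InfiniteSquare.
Context d (W : orderType d) (wfW : is_ordinal W).

Let below (S : set W) w := S `&` [set a | a < w].

Let square_le (S : set W) := infinite_set S -> S `*` S #<= S.

(* Goedel's pairing: order pairs by their maximum first, so that a pair has
   few predecessors. *)
Lemma square_le_below S :
  (forall w, S w -> square_le (below S w)) -> square_le S.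
Proof.
move=> IH Sinf.
have [[w [Sw Sle]]|initS] := pselect (exists w, S w /\ S #<= below S w).
  have winf : infinite_set (below S w) by move=> /(card_le_finite Sle).
  apply: card_le_trans (card_setX_le Sle Sle) (card_le_trans (IH w Sw winf) _).
  by apply: subset_card_le => a [].
pose key (p : W * W) : W *l (W *l W) := (Order.max p.1 p.2, p).
have key_inj : injective key by move=> p q [].
have keyS : key @` (S `*` S) #= S `*` S by exact: inj_card_eq (in2W _).
rewrite -(card_le_eql keyS).
apply: (ordinal_card_le (lexi_ordinal wfW (lexi_ordinal wfW wfW))).
move=> _ [[p q] [/= Sp Sq] <-] Sle.
set m := Order.max p q in Sle; pose M := below S m.
have Sm : S m by rewrite /m; case: (leP p q).
have predS : S #<= (M `|` [set m]) `*` (M `|` [set m]).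
  apply: card_le_trans Sle _; apply: (sub_image_card_le (f := key)).
  move=> _ [[[a b] [/= Sa Sb] <-]].
  rewrite /= Order.ProdLexiOrder.ltEprodlexi /= ge_max !le_eqVlt.
  move=> /andP[/andP[am bm] _]; exists (a, b) => //; split=> /=.
    by case/orP: am => [/eqP|]; [right|left].
  by case/orP: bm => [/eqP|]; [right|left].
have m1 := finite_set1 m.
have [Mfin|Minf] := pselect (finite_set M).
  have MU : finite_set (M `|` [set m]) by rewrite finite_setU.
  exact/Sinf/(card_le_finite predS)/finite_setX.
apply: initS; exists m; split=> //; apply: card_le_trans predS _.
have MU : M `|` [set m] #<= M.
  apply: card_le_trans (card_setU_square_le Minf _ _) (IH m Sm Minf) => //.
  exact: finite_card_le.
exact: card_le_trans (card_setX_le MU MU) (IH m Sm Minf).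
Qed.

Lemma ordinal_square_le S : square_le S.
Proof.
apply: square_le_below => w _; elim/(well_founded_ind wfW): w => w IH.
apply: square_le_below => v [_ vw].
suff -> : below (below S w) v = below S v by exact: IH.
rewrite /below -setIA; congr (_ `&` _).
by apply/seteqP; split=> [a []//|a av]; split=> //; exact: lt_trans vw.
Qed.

End InfiniteSquare.

Lemma infinite_square_le T (A : set T) : infinite_set A -> A `*` A #<= A.
Proof.
have [d [W [f [wfW f_inj]]]] := well_orderable T.
have fA : f @` A #= A by exact: inj_card_eq (in2W _).
have [lefA leAf] : f @` A #<= A /\ A #<= f @` A.
  by rewrite (card_le_eql fA) (card_le_eqr fA) card_lexx.
move=> Ainf; apply: card_le_trans lefA.
apply: card_le_trans (card_setX_le leAf leAf) _.
by apply: (ordinal_square_le wfW) => /(card_le_finite leAf).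
Qed.

Lemma card_bigcup_le T I U (J : set I) (F : I -> set T) (B : set U) :
  infinite_set B -> J #<= B -> (forall i, J i -> F i #<= B) ->
  \bigcup_(i in J) F i #<= B.
Proof.
move=> Binf JB FB.
exact: card_le_trans (card_bigcup_square_le JB FB) (infinite_square_le Binf).
Qed.

Lemma card_setU_le T U (A B : set T) (C : set U) :
  infinite_set C -> A #<= C -> B #<= C -> A `|` B #<= C.
Proof.
move=> Cinf AC BC.
exact: card_le_trans (card_setU_square_le Cinf AC BC) (infinite_square_le Cinf).
Qed.

Lemma card_lt_setU T U (A B : set T) (C : set U) :
  infinite_set C -> A #< C -> B #< C -> A `|` B #< C.
Proof.
move=> Cinf; wlog AB : A B / A #<= B => [IH AC BC|_ BC].
  have /orP[AB|BA] := card_le_total A B; first exact: IH.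
  by rewrite setUC; exact: IH.
have [Bfin|Binf] := pselect (finite_set B); last first.
  by apply: card_le_lt_trans BC; exact: card_setU_le.
rewrite card_ltNge; apply/negP => /card_le_finite CU; apply/Cinf/CU.
by rewrite finite_setU; split=> //; exact: card_le_finite Bfin.
Qed.

(** * Cofinality and successor cardinals *)

(* [lt_cof A W] says that the cardinality of [A] is below the cofinality of
   [W]. *)
Definition lt_cof X (A : set X) d (W : orderType d) : Prop :=
  forall S : set W, S #<= A -> exists w, forall s, S s -> s < w.

Definition regular d (W : orderType d) : Prop :=
  forall w : W, lt_cof [set a | a < w] W.

Lemma lt_cof_le X (A : set X) Y (B : set Y) d (W : orderType d) :
  A #<= B -> lt_cof B W -> lt_cof A W.
Proof. by move=> AB BW S SA; apply: BW; exact: card_le_trans AB. Qed.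

Lemma lt_cof_bound X (A : set X) d (W : orderType d) (f : X -> W) :
  lt_cof A W -> exists w, forall x, A x -> f x < w.
Proof.
move=> /(_ (f @` A) (card_image_le f A))[w wP].
by exists w => x Ax; apply: wP; exists x.
Qed.

Lemma lt_cof_nomax X (A : set X) d (W : orderType d) (w : W) :
  A !=set0 -> lt_cof A W -> exists v, w < v.
Proof. by move=> [a Aa] /(lt_cof_bound (fun=> w))[v /(_ a Aa)]; exists v. Qed.

Lemma lt_cof_setX X (A : set X) Y (B : set Y) d (W : orderType d) :
  lt_cof A W -> lt_cof B W -> lt_cof (A `*` B) W.
Proof.
move=> AW BW S; have [w0 _] := AW set0 (card_ge0 _ _).
move=> /(card_le_sub_image w0)[f SfAB].
have /choice[u uP] x : exists w, forall y, B y -> f (x, y) < w.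
  exact: lt_cof_bound (fun y => f (x, y)) BW.
have [w wP] := lt_cof_bound u AW.
exists w => _ /SfAB[[x y] [/= Ax By] <-].
exact: lt_trans (uP x y By) (wP x Ax).
Qed.

Lemma small_segments_lt_cof d (W : orderType d) X (A : set X) :
  infinite_set A -> (forall w : W, [set a | a < w] #<= A) ->
  A #< [set: W] -> lt_cof A W.
Proof.
move=> Ainf segA; rewrite card_ltNge => /negP AW S SA.
apply: contrapT => unb; apply: AW.
suff -> : [set: W] = \bigcup_(s in S) ([set a | a < s] `|` [set s]).
  apply: card_bigcup_le => // s _; apply: card_setU_le => //.
  exact/finite_card_le.
apply/esym/seteqP; split=> // w _; apply: contrapT => nw; apply: unb.
exists w => s Ss; rewrite ltNge le_eqVlt; apply/negP => /orP ws; apply: nw.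
by exists s => //; case: ws => [/eqP|]; [right|left].
Qed.

Section SuccessorCardinal.
Context dL (L : orderType dL) dM (M : orderType dM).
Hypotheses (Minf : infinite_set [set: M]) (succL : is_successor_cardinal L M).

Lemma successor_segment_le (w : L) : [set a | a < w] #<= [set: M].
Proof.
have [[_ cardL] _ minL] := succL; rewrite card_leNgt; apply/negP => /minL.
by apply/negP; rewrite -card_ltNge.
Qed.

Lemma successor_lt_cof : lt_cof [set: M] L.
Proof.
by apply: small_segments_lt_cof successor_segment_le _ => //; case: succL.
Qed.

Lemma successor_regular : regular L.
Proof.
by move=> w; exact: lt_cof_le (successor_segment_le w) successor_lt_cof.
Qed.

Lemma successor_infinite : infinite_set [set: L].
Proof. by have [_ /card_ltW ML _] := succL; move/(card_le_finite ML). Qed.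

End SuccessorCardinal.

Definition segment d (W : orderType d) (b : W) : Type :=
  {a : W | a \in [set c | c < b]}.

HB.instance Definition _ d (W : orderType d) (b : W) :=
  SubChoice.on (segment b).
HB.instance Definition _ d (W : orderType d) (b : W) :=
  [SubChoice_isSubOrder of segment b by <: with d].

Lemma segment_ordinal d (W : orderType d) (b : W) :
  is_ordinal W -> is_ordinal (segment b).
Proof.
move=> wfW s; move: {2}(val s) (erefl (val s)) => a.
elim/(well_founded_ind wfW): a s => a IH s sE.
by constructor=> t ts; apply: (IH (val t)) => //; rewrite -sE.
Qed.

Lemma card_segment d (W : orderType d) (b : W) :
  [set: segment b] #= [set a | a < b].
Proof. exact: (card_setT [set a | a < b]). Qed.

Lemma card_segment_lt d (W : orderType d) (b : W) :
  is_cardinal W -> [set: segment b] #< [set: W].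
Proof.
by move=> [_ /(_ b)]; rewrite !card_ltNge (card_le_eqr (card_segment b)).
Qed.

Lemma card_segment_below_le d (W : orderType d) (b : W) (s : segment b) :
  [set a | a < s] #<= [set a | a < val s].
Proof. by apply: (set_inj_card_le (f := val)) => // u v _ _ /val_inj. Qed.

(* A cardinal above its cofinality is a limit cardinal. *)
Lemma limit_cardinal_successor dM (M : orderType dM) dT (T : orderType dT)
    dK (K : orderType dK) :
  is_cardinal M -> is_cofinality T M -> infinite_set [set: K] ->
  [set: T] #<= [set: K] -> [set: K] #< [set: M] ->
  exists b : M, is_successor_cardinal (segment b) K.
Proof.
move=> [wfM _] [_ [A cofA AT] _] Kinf TK KM.
have [b Kb bmin] : exists2 b : M, [set: K] #< [set c | c < b] &
    forall a, [set: K] #< [set c | c < a] -> b <= a.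
  apply: ordinal_least => //; apply: contrapT => nb.
  have segK (w : M) : [set c | c < w] #<= [set: K].
    by rewrite card_leNgt; apply/negP => Kw; apply: nb; exists w.
  have AK : A #<= [set: K] by rewrite (card_le_eql AT).
  have [w wP] := small_segments_lt_cof Kinf segK KM AK.
  by have [y Ay] := cofA w; rewrite leNgt wP.
have segK (a : M) : a < b -> [set c | c < a] #<= [set: K].
  by move=> ab; rewrite card_leNgt; apply/negP => /bmin; rewrite leNgt ab.
have Ksegb : [set: K] #< [set: segment b].
  by move: Kb; rewrite !card_ltNge (card_le_eql (card_segment b)).
exists b; split; [split; first exact: segment_ordinal|by []|].
  move=> s; have sb : val s < b by have := valP s; rewrite inE.
  apply: card_le_lt_trans Ksegb.
  exact: card_le_trans (card_segment_below_le s) (segK _ sb).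
move=> U B; rewrite card_ltNge => /negP KB.
rewrite (card_le_eql (card_segment b)).
apply: (ordinal_card_le wfM) => a ab Ba; apply/KB/(card_le_trans Ba).
by apply: card_le_trans (segK a ab); apply: subset_card_le => c [].
Qed.

(** * Club guessing *)

Definition is_strict_sup d (W : orderType d) (A : set W) (s : W) : Prop :=
  (forall a, A a -> a < s) /\ (forall v, v < s -> exists2 a, A a & v <= a).

Lemma strict_sup_image_exists d (W : orderType d) X (A : set X) (f : X -> W) :
  is_ordinal W -> lt_cof A W -> exists s, is_strict_sup (f @` A) s.
Proof.
move=> wfW /(_ (f @` A) (card_image_le f A)) /(ordinal_least wfW)[s sA s_min].
exists s; split=> // v vs; apply: contrapT => nv.
move: vs; rewrite ltNge => /negP; apply; apply: s_min => a Aa.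
by rewrite ltNge; apply/negP => va; apply: nv; exists a.
Qed.

Lemma increasing_family_in d (W : orderType d) d' (N : orderType d')
    (E : set W) :
  is_ordinal N -> lt_cof [set: N] W -> (forall w, exists2 s, w < s & E s) ->
  exists e : N -> W, (forall n, E (e n)) /\ {homo e : m n / m < n}.
Proof.
move=> wfN NW Eunb; have [w0 _] := NW set0 (card_ge0 _ _).
have [e eP] : exists e : N -> W, forall n,
    E (e n) /\ forall m, m < n -> e m < e n.
  apply: (ordinal_choice_recursion w0 (P := fun n e v =>
    E v /\ forall m, m < n -> e m < v)) => // [n e e' v ee' [Ev ev]|n e _].
    by split=> // m mn; rewrite -ee' //; exact: ev.
  have [w wP] := lt_cof_bound e NW; have [s ws Es] := Eunb w.
  by exists s; split=> // m _; apply: lt_trans ws; exact: wP.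
by exists e; split=> [n|m n]; have [] := eP n => // _; apply.
Qed.

Lemma nonincreasing_eventually_constant d (W : orderType d)
    d' (I : orderType d') (f : I -> W) :
  is_ordinal W -> [set: I] !=set0 -> {homo f : i k / i <= k >-> k <= i} ->
  exists i, forall k, i <= k -> f k = f i.
Proof.
move=> wfW [i0 _] f_noninc.
have [|_ [i _ <-] fi_min] := ordinal_least wfW (A := range f).
  by exists (f i0), i0.
exists i => k ik; apply/eqP; rewrite eq_le f_noninc //=.
by apply: fi_min; exists k.
Qed.

Lemma nonincreasing_family_eventually_constant d (W : orderType d)
    d' (I : orderType d') N (f : I -> N -> W) :
  is_ordinal W -> lt_cof [set: N] I ->
  (forall n, {homo f^~ n : i k / i <= k >-> k <= i}) ->
  exists i, forall n k, i <= k -> f k n = f i n.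
Proof.
move=> wfW NI f_noninc; have [i0 _] := NI set0 (card_ge0 _ _).
have /choice[stage stageP] n : exists i, forall k, i <= k -> f k n = f i n.
  apply: nonincreasing_eventually_constant (f_noninc n) => //.
  by exists i0.
have [i iP] := lt_cof_bound stage NI.
have stage_le n : stage n <= i by exact/ltW/iP.
by exists i => n k ik; rewrite stageP ?(stageP n i) //; exact: le_trans ik.
Qed.

Section ClosurePoints.
Context d (W : orderType d) (wfW : is_ordinal W).

Definition closure_points (g : W -> W) : set W :=
  [set s | forall t, t < s -> g t < s].

Lemma closure_points_unbounded (g : W -> W) :
  lt_cof [set: nat] W -> regular W ->
  forall s0, exists2 s, s0 < s & closure_points g s.
Proof.
move=> natW regW s0.
have /choice[h hP] : forall u : W, exists v, forall t, t <= u -> g t < v.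
  move=> u; have [|v uv] := lt_cof_nomax u _ natW; first by exists 0%N.
  have [w wP] := lt_cof_bound g (regW v).
  by exists w => t tu; apply: wP; exact: le_lt_trans uv.
pose u n := iter n h s0.
have [s [us s_le]] := strict_sup_image_exists u wfW natW.
exists s; first by apply: us; exists 0%N.
move=> t /s_le[_ [n _ <-] /hP gt]; apply: lt_trans gt _.
by apply: us; exists n.+1.
Qed.

Context I (J : set I) (g : I -> W -> W).

Let E := \bigcap_(j in J) closure_points (g j).

Lemma bigcap_closure_points_unbounded :
  lt_cof [set: nat] W -> regular W -> lt_cof J W ->
  forall s0, exists2 s, s0 < s & E s.
Proof.
move=> natW regW JW s0.
have /choice[b bP] : forall t, exists b, forall j, J j -> g j t < b.
  by move=> t; exact: lt_cof_bound (g^~ t) JW.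
have [s ws sP] := closure_points_unbounded b natW regW s0.
by exists s => // j Jj t ts; apply: lt_trans (bP t j Jj) (sP t ts).
Qed.

Definition last_le (D : set W) (w : W) : W :=
  xget w [set p | [/\ D p, p <= w & forall e, D e -> e <= w -> e <= p]].

(* The maximum is attained, since closure points form a closed set containing
   the least element. *)
Lemma last_le_closure_pointsP w :
  [/\ E (last_le E w), last_le E w <= w &
      forall e, E e -> e <= w -> e <= last_le E w].
Proof.
pose ub p := forall e, E e -> e <= w -> e <= p.
suff : exists p, [/\ E p, p <= w & ub p] by move/(xgetPex w).
have [|p p_ub p_min] := ordinal_least wfW (A := ub); first by exists w => e.
exists p; split=> //; last by apply: p_min => e.
move=> j Jj t tp.
have [e [Ee ew te]] : exists e, [/\ E e, e <= w & t < e].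
  apply: contrapT => ne; move: tp; rewrite ltNge => /negP; apply.
  apply: p_min => e Ee ew; rewrite leNgt; apply/negP => te.
  by apply: ne; exists e.
exact: lt_le_trans (Ee j Jj t te) (p_ub e Ee ew).
Qed.

End ClosurePoints.

Section ClubGuessing.
Context dW (W : orderType dW) dI (I : orderType dI) dN (N : orderType dN).

Definition guesses (c : N -> W) (g : W -> W) : Prop :=
  [/\ {homo c : n m / n <= m},
      forall n, closure_points g (c n) &
      forall n, exists m, c n < c m].

Definition is_ladder (w : W) (a : N -> W) : Prop :=
  [/\ {homo a : n m / n <= m}, forall n, a n < w &
      forall t, t < w -> exists n, t <= a n].

Definition ladder (w : W) : N -> W := xget (fun=> w) [set a | is_ladder w a].

Definition guess_candidate (g : I -> W -> W) i w n : W :=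
  last_le (\bigcap_(k in [set k | k < i]) closure_points (g k)) (ladder w n).

Hypotheses (wfW : is_ordinal W) (wfI : is_ordinal I) (wfN : is_ordinal N).
Hypotheses (natW : lt_cof [set: nat] W) (regW : regular W).
Hypotheses (IW : lt_cof [set: I] W) (NI : lt_cof [set: N] I).
Hypotheses (NW : lt_cof [set: N] W) (nomaxN : forall n : N, exists m, n < m).

Lemma guess_candidate_noninc g w n :
  {homo guess_candidate g ^~ w ^~ n : i k / i <= k >-> k <= i}.
Proof.
have lastP i := last_le_closure_pointsP wfW [set k | k < i] g (ladder w n).
move=> i k ik; have [Ep pw _] := lastP k; have [_ _] := lastP i; apply=> //.
by move=> l /= li; apply: Ep; exact: lt_le_trans ik.
Qed.

(* For each [n] the values [guess_candidate g i w n] decrease with [i], hence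
   are eventually constant; a candidate taken after all of them have stabilized
   consists of closure points of its own [g i]. *)
Lemma guess_candidate_guesses g :
  exists w i, guesses (guess_candidate g i w) (g i).
Proof.
have lastP i w n := last_le_closure_pointsP wfW [set k | k < i] g (ladder w n).
pose EI := \bigcap_i closure_points (g i).
have EI_unb : forall w, exists2 s, w < s & EI s.
  exact: bigcap_closure_points_unbounded.
have [e [eE e_incr]] := increasing_family_in wfN NW EI_unb.
have [w [ew w_le]] := strict_sup_image_exists e wfW NW.
have [a_homo aw a_cof] : is_ladder w (ladder w).
  apply: (xgetPex (fun=> w)); exists e; split=> [n m|n|t /w_le[_ [n _ <-]]].
  - by rewrite le_eqVlt => /orP[/eqP->//|/e_incr/ltW].
  - by apply: ew; exists n.
  - by exists n.
have [i iP] := nonincreasing_family_eventually_constant wfW NI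
  (guess_candidate_noninc g w).
exists w, i; split=> [n m nm|n|n].
- have [Ep pw _] := lastP i w n; have [_ _] := lastP i w m; apply=> //.
  exact: le_trans pw (a_homo n m nm).
- have [|j ij] := lt_cof_nomax i _ NI; first by exists n.
  rewrite -(iP n j (ltW ij)).
  by have [Ep _ _] := lastP j w n; exact: Ep.
- have /w_le[_ [k _ <-] ank] := aw n; have [k' kk'] := nomaxN k.
  have [m em] : exists m, e k' <= ladder w m.
    by apply: a_cof; apply: ew; exists k'.
  have [_ pw _] := lastP i w n; have [_ _ p_max] := lastP i w m; exists m.
  apply: le_lt_trans (le_trans pw ank) (lt_le_trans (e_incr _ _ kk') _).
  by apply: p_max em => l _; exact: eE.
Qed.

(* If no family of candidates guesses everything, each [g i] can be chosen to
   refute the candidates built from the earlier ones. *)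
Lemma refuting_family :
  exists g, forall i,
    (exists h, forall w, ~ guesses (guess_candidate g i w) h) ->
    forall w, ~ guesses (guess_candidate g i w) (g i).
Proof.
pose P i g h' := (exists h, forall w, ~ guesses (guess_candidate g i w) h) ->
  forall w, ~ guesses (guess_candidate g i w) h'.
apply: (ordinal_choice_recursion id (P := P)) => // [i g g' h gg'|i g _].
  suff candE : guess_candidate g i = guess_candidate g' i by rewrite /P candE.
  apply/funext => w; apply/funext => n; congr last_le.
  by apply: eq_bigcapr => k /gg'->.
pose refutes h := forall w, ~ guesses (guess_candidate g i w) h.
by exists (xget (id : W -> W) refutes); exact: xgetPex.
Qed.

Lemma club_guessing :
  exists c : W * I -> N -> W, forall g, exists wi, guesses (c wi) g.
Proof.
have [g g_refutes] := refuting_family.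
exists (fun wi => guess_candidate g wi.2 wi.1) => h; apply: contrapT => none.
have [w [i]] := guess_candidate_guesses g; apply: g_refutes.
by exists h => v hv; apply: none; exists (v, i).
Qed.

End ClubGuessing.

(** * Stabilization of eventually increasing sequences *)

Section SupBelow.
Context dR (R : orderType dR) dL (L : orderType dL) (l0 : L).
Hypotheses (wfL : is_ordinal L) (RL : lt_cof [set: R] L).

Definition sup_below (z : R -> L) (s : R) : L :=
  xget l0 (is_strict_sup (z @` [set t | t < s])).

Lemma sup_belowP z s : is_strict_sup (z @` [set t | t < s]) (sup_below z s).
Proof.
apply: xgetPex.
exact: strict_sup_image_exists z wfL (lt_cof_le (card_leT _) RL).
Qed.

Lemma eq_sup_below z z' s : (forall t, t < s -> z t = z' t) ->
  forall r, r <= s -> sup_below z r = sup_below z' r.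
Proof.
move=> zz' r rs; rewrite /sup_below.
suff -> : z @` [set t | t < r] = z' @` [set t | t < r] by [].
by apply: eq_imagel => t /= tr; apply: zz'; exact: lt_le_trans rs.
Qed.

Lemma lt_sup_below z t s : t < s -> z t < sup_below z s.
Proof. by move=> ts; have [+ _] := sup_belowP z s; apply; exists t. Qed.

Lemma sup_below_le z s v : v < sup_below z s -> exists2 t, t < s & v <= z t.
Proof. by have [_ cof /cof[_ [t ts <-]]] := sup_belowP z s; exists t. Qed.

Section Interleaved.
Variables (z : R -> L) (delta : L).
Hypotheses (z_ge : forall s, sup_below z s <= z s).
Hypotheses (nomaxR : forall r : R, exists s, r < s).
Hypotheses (deltaP : is_strict_sup (range z) delta).

Local Notation sigma := (sup_below z).

Lemma sup_below_incr : {homo sigma : t s / t < s}.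
Proof. by move=> t s /(lt_sup_below z); exact: le_lt_trans. Qed.

Lemma sup_below_lt s : sigma s < delta.
Proof. by apply: le_lt_trans (z_ge s) _; apply: (proj1 deltaP); exists s. Qed.

Lemma lt_sup_range v : v < delta -> exists s, v < sigma s.
Proof.
move=> /(proj2 deltaP)[_ [t _ <-] vt]; have [s ts] := nomaxR t.
by exists s; apply: le_lt_trans vt _; exact: lt_sup_below.
Qed.

Lemma sup_range_limit : [set: R] !=set0 -> is_limit delta.
Proof.
move=> [r0 _]; split=> [|a /lt_sup_range[s as_]].
  by exists (sigma r0); exact: sup_below_lt.
by exists (sigma s) => //; exact: sup_below_lt.
Qed.

Lemma club_closure_points C : club_in C delta ->
  exists h, forall s, closure_points h s -> (exists r, r < s) -> C (sigma s).
Proof.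
move=> [_ Cunb Cclosed].
have /choice[h hP] t : exists s, exists2 q, C q & z t <= q /\ q < sigma s.
  have [|q Cq [tq /lt_sup_range[s qs]]] := Cunb (z t).
    by apply: (proj1 deltaP); exists t.
  by exists s, q.
exists h => s s_closed [r rs]; apply: Cclosed; first exact: sup_below_lt.
  split=> [|a /sup_below_le[t ts at_]].
    by exists (sigma r); exact: sup_below_incr.
  have [q _ [tq qh]] := hP t.
  exists (sigma (h t)); first exact: le_lt_trans at_ (le_lt_trans tq qh).
  exact/sup_below_incr/s_closed.
move=> a /sup_below_le[t ts at_]; have [q Cq [tq qh]] := hP t.
exists q => //; split; first exact: le_trans at_ tq.
by apply: lt_trans qh _; exact/sup_below_incr/s_closed.
Qed.

End Interleaved.
End SupBelow.

Lemma nondecreasing_sets_eventually_constant X (A : set X) d (N : orderType d)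
    (H : N -> set X) :
  lt_cof A N -> {homo H : n m / n <= m >-> n `<=` m} ->
  (forall n, H n `<=` A) -> exists n, forall m, H m `<=` H n.
Proof.
move=> AN H_homo HA; have [n0 _] := AN set0 (card_ge0 _ _).
pose entry x := xget n0 [set n | H n x].
have [n nP] := lt_cof_bound entry AN.
exists n => m x Hm; apply: (H_homo (entry x) n (ltW (nP x (HA m x Hm)))).
by apply: (xgetPex n0 (P := [set n | H n x])); exists m.
Qed.

Section EventualInclusion.
Context dT (T : orderType dT) (Y : Type).
Implicit Types F G H : T -> set Y.

Definition eventually_sub F G : Prop :=
  exists i, forall j, i <= j -> F j `<=` G j.

Lemma eventually_sub_trans G F H :
  eventually_sub F G -> eventually_sub G H -> eventually_sub F H.
Proof.
move=> [i FG] [k GH]; exists (Order.max i k) => j.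
by rewrite ge_max => /andP[/FG + /GH]; exact: subset_trans.
Qed.

Definition eventually_eq F G : Prop := exists i, forall j, i <= j -> F j = G j.

Lemma eventually_sub_anti F G :
  eventually_sub F G -> eventually_sub G F -> eventually_eq F G.
Proof.
move=> [i FG] [k GF]; exists (Order.max i k) => j.
by rewrite ge_max => /andP[/FG FGj /GF GFj]; apply/seteqP.
Qed.

End EventualInclusion.

Section Stabilization.
Context dT (T : orderType dT) (Y : Type) dL (L : orderType dL).
Variable F : L -> T -> set Y.

Definition eventually_increasing : Prop :=
  forall b g, b <= g -> eventually_sub (F b) (F g).

Definition club_uniform : Prop :=
  forall delta, is_limit delta -> exists i, exists2 C : set L, club_in C delta &
    forall g, C g -> forall j, i <= j -> F g j `<=` F delta j.

Definition unstable : Prop :=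
  forall b, exists2 g, b <= g & ~ eventually_sub (F g) (F b).

Hypotheses (wfL : is_ordinal L) (F_incr : eventually_increasing).

(* Each [Q q] is a demand, met by [F g] if eventually included in it. *)
Lemma unstable_meets_demands X (Q : X -> T -> set Y) (b : L) :
  unstable -> lt_cof [set: X] L ->
  exists g, [/\ b <= g, ~ eventually_sub (F g) (F b) &
    forall q, (exists b', eventually_sub (Q q) (F b')) ->
      eventually_sub (Q q) (F g)].
Proof.
move=> F_unst XL.
pose u q := xget b [set b' | eventually_sub (Q q) (F b')].
have [v vP] := lt_cof_bound u XL.
have [g] := F_unst (Order.max b v); rewrite ge_max => /andP[bg vg] Fg.
exists g; split=> // [Fgb|q /(xgetPex b) Qu].
  apply/Fg/(eventually_sub_trans Fgb); apply: F_incr.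
  by rewrite le_max lexx.
apply: eventually_sub_trans Qu _; apply: F_incr.
exact: le_trans (ltW (vP q I)) vg.
Qed.

Context dR (R : orderType dR).
Hypotheses (wfR : is_ordinal R) (RL : lt_cof [set: R] L).

Definition union_along (sigma : R -> L) (B : set R) (j : T) : set Y :=
  \bigcup_(s in B) F (sigma s) j.

Lemma demanding_sequence X (B : X -> set R) (l0 : L) :
  unstable -> lt_cof [set: X] L ->
  exists z : R -> L, let sigma := sup_below l0 z in forall s,
    [/\ sigma s <= z s, ~ eventually_sub (F (z s)) (F (sigma s)) &
      forall x, B x `<=` [set t | t <= s] ->
        (exists b, eventually_sub (union_along sigma (B x)) (F b)) ->
        eventually_sub (union_along sigma (B x)) (F (z s))].
Proof.
move=> F_unst XL.
pose P s z v := let sigma := sup_below l0 z in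
  [/\ sigma s <= v, ~ eventually_sub (F v) (F (sigma s)) &
    forall x, B x `<=` [set t | t <= s] ->
      (exists b, eventually_sub (union_along sigma (B x)) (F b)) ->
      eventually_sub (union_along sigma (B x)) (F v)].
apply: (ordinal_choice_recursion l0 (P := P)) => // [s z z' v zz'|s z _].
  have sigmaE := eq_sup_below l0 zz'.
  rewrite /P /= -(sigmaE s (lexx s)) => -[le_v Fv demands]; split=> // x Bxs.
  suff unionE : union_along (sup_below l0 z) (B x) =
                union_along (sup_below l0 z') (B x).
    by rewrite -unionE; exact: demands.
  by apply/funext => j; apply: eq_bigcupr => t /Bxs /sigmaE ->.
have [g [sg Fg demands]] := unstable_meets_demands
  (fun x => union_along (sup_below l0 z) (B x)) (sup_below l0 z s) F_unst XL.
by exists g; split=> // x _; exact: demands.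
Qed.

Lemma club_uniform_closure_points (l0 : L) (z : R -> L) :
  club_uniform -> [set: R] !=set0 -> (forall r : R, exists s, r < s) ->
  (forall s, sup_below l0 z s <= z s) ->
  exists delta h i, forall s, closure_points h s ->
    forall j, i <= j -> F (sup_below l0 z s) j `<=` F delta j.
Proof.
move=> F_unif R0 nomaxR z_ge.
have [delta deltaP] := strict_sup_image_exists z wfL RL.
have delta_limit := sup_range_limit wfL RL z_ge nomaxR deltaP R0.
have [i [C clubC FC]] := F_unif delta delta_limit.
have [h hC] := club_closure_points wfL RL z_ge nomaxR deltaP clubC.
have [r0 _ r0_min] := ordinal_least wfR R0.
have [i0 Fr0] := F_incr (ltW (sup_below_lt z_ge deltaP r0)).
exists delta, h, (Order.max i0 i) => s s_closed j.
rewrite ge_max => /andP[i0j ij].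
have [r0s|s_le] := ltP r0 s.
  by apply: FC => //; apply: hC => //; exists r0.
have -> : s = r0 by apply/le_anti; rewrite s_le r0_min.
exact: Fr0.
Qed.

Lemma met_demands_stop_growth dN (N : orderType dN) (x : set Y) (l0 : L)
    (z : R -> L) (c : N -> R) :
  let sigma := sup_below l0 z in
  lt_cof (x `*` [set: T]) N -> (forall b j, F b j `<=` x) ->
  {homo c : n m / n <= m} -> (forall n, exists m, c n < c m) ->
  (forall n, eventually_sub (union_along sigma (c @` [set k | k <= n]))
               (F (z (c n)))) ->
  exists m, eventually_sub (F (z (c m))) (F (sigma (c m))).
Proof.
move=> sigma xTN Fx c_homo c_grows demands.
pose U n := union_along sigma (c @` [set k | k <= n]).
have F_sigma s t : s < t -> eventually_sub (F (z s)) (F (sigma t)).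
  by move=> st; apply/F_incr/ltW/lt_sup_below.
have [n U_n] : exists n, forall m,
    [set p | U m p.2 p.1] `<=` [set p | U n p.2 p.1].
  apply: (nondecreasing_sets_eventually_constant xTN) => [n m nm|n] [y j] /=.
    move=> [_ [k kn <-] Fy]; exists (c k) => //.
    by exists k => //; exact: le_trans nm.
  by move=> [s _ /Fx].
have [m nm] := c_grows n; have [m' mm'] := c_grows m; exists m.
apply: eventually_sub_trans (F_sigma _ _ mm') _.
apply: (@eventually_sub_trans _ _ _ (U n)); last first.
  exact: eventually_sub_trans (demands n) (F_sigma _ _ nm).
have [i _] := F_incr (lexx (z (c n))).
exists i => j _ y Fy; apply: (U_n m' (y, j)).
by exists (c m') => //; exists m' => /=.
Qed.

End Stabilization.

Section StabilizationBelowSuccessors.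
Context dK (K : orderType dK) dN (N : orderType dN).
Context dI (I : orderType dI) dR (R : orderType dR).
Hypotheses (Kinf : infinite_set [set: K]) (succN : is_successor_cardinal N K).
Hypotheses (succI : is_successor_cardinal I N).
Hypotheses (succR : is_successor_cardinal R I).

Lemma successors_club_guessing :
  exists c : R * I -> N -> R, forall g, exists ri, guesses (c ri) g.
Proof.
have Ninf := successor_infinite Kinf succN.
have Iinf := successor_infinite Ninf succI.
have [[wfN _] _ _] := succN; have [[wfI _] NI _] := succI.
have [[wfR _] _ _] := succR.
have IR_cof := successor_lt_cof Iinf succR.
apply: club_guessing => //.
- by apply: lt_cof_le IR_cof; exact/infiniteP.
- exact: successor_regular succR.
- exact: successor_lt_cof succI.
- exact: lt_cof_le (card_ltW NI) IR_cof.
- move=> n; apply: lt_cof_nomax (successor_lt_cof Kinf succN).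
  exact: infinite_setN0.
Qed.

Context dT (T : orderType dT) (Y : Type) dL (L : orderType dL).
Variables (F : L -> T -> set Y) (x : set Y).
Hypotheses (wfL : is_ordinal L) (RL : lt_cof [set: R] L).
Hypotheses (TK : [set: T] #<= [set: K]) (xK : x #<= [set: K]).

Lemma eventually_increasing_stabilizes :
  eventually_increasing F -> club_uniform F -> (forall b j, F b j `<=` x) ->
  exists b, forall g, b <= g -> eventually_sub (F g) (F b).
Proof.
move=> F_incr F_unif Fx; apply: contrapT => unstab.
have F_unst : unstable F.
  move=> b; apply: contrapT => nb; apply: unstab; exists b => g bg.
  by apply: contrapT => Fg; apply: nb; exists g.
have Ninf := successor_infinite Kinf succN.
have Iinf := successor_infinite Ninf succI.
have Rinf := successor_infinite Iinf succR.
have [_ NI _] := succI; have [[wfR _] IR _] := succR.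
have [l0 _] := RL (card_ge0 _ _).
have RIN_L : lt_cof [set: (R * I) * N] L.
  have IL : lt_cof [set: I] L := lt_cof_le (card_ltW IR) RL.
  rewrite -!setXTT; do 2?apply: lt_cof_setX => //.
  exact: lt_cof_le (card_ltW NI) IL.
have [c c_guesses] := successors_club_guessing.
pose B (q : (R * I) * N) := c q.1 @` [set k | k <= q.2].
have [z zP] := demanding_sequence F_incr wfR B l0 F_unst RIN_L.
have nomaxR (r : R) : exists s, r < s.
  exact: lt_cof_nomax (infinite_setN0 Iinf) (successor_lt_cof Iinf succR).
have z_ge s : sup_below l0 z s <= z s by have [] := zP s.
have [delta [h [i F_deltaP]]] := club_uniform_closure_points
  wfL F_incr wfR RL F_unif (infinite_setN0 Rinf) nomaxR z_ge.
have [ri [c_homo c_closed c_grows]] := c_guesses h.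
have xTN : lt_cof (x `*` [set: T]) N.
  by apply: lt_cof_setX; apply: lt_cof_le (successor_lt_cof Kinf succN).
have [n|m] := met_demands_stop_growth wfL F_incr RL
  (l0 := l0) (z := z) xTN Fx c_homo c_grows.
  have [_ _ demands] := zP (c ri n).
  apply: (demands (ri, n)) => [_ [k kn <-]|]; first exact: c_homo.
  by exists delta, i => j ij; apply: bigcup_sub => _ [k _ <-]; exact: F_deltaP.
by have [] := zP (c ri m).
Qed.

End StabilizationBelowSuccessors.

(** * From stable traces to the covering property *)

Section LeastWitnessColoring.
Context d (P : porderType d) dT (T : orderType dT) (wfT : is_ordinal T).
Variable agree : P -> P -> set T.
Hypothesis agree_up : forall u v i j, i <= j -> agree u v i -> agree u v j.
Hypothesis agree_ex : forall u v, u < v -> exists i, agree u v i.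
Hypothesis agree_trans : forall u v w i, u < v -> v < w ->
  agree u v i -> agree v w i -> agree u w i.
Hypothesis agree_cancel : forall u v w i, u < v -> v < w ->
  agree u w i -> agree v w i -> agree u v i.

(* The least witness of agreement is a subadditive coloring. *)
Lemma agree_on_cofinal :
  (~ exists c : pairs P -> T, subadditive c /\ strongly_unbounded c) ->
  exists2 G : set P, cofinal G &
    exists i, forall u v, G u -> G v -> u < v -> agree u v i.
Proof.
move=> no_coloring; apply: contrapT => no_agree; apply: no_coloring.
have /choice[c cP] (p : pairs P) : exists i, agree (val p).1 (val p).2 i /\
    forall k, agree (val p).1 (val p).2 k -> i <= k.
  case: p => -[u v] /= uv.
  by have [i ai i_min] := ordinal_least wfT (agree_ex uv); exists i.
have cE u v (uv : u < v) i : c (mkpair uv) <= i -> agree u v i.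
  by have [auv _] := cP (mkpair uv) => /agree_up; exact.
exists c; split=> [u v w uv vw uw|G cofG i].
  split.
    apply: (proj2 (cP (mkpair uw))) => /=.
    by apply: (agree_trans uv vw); apply: cE; rewrite le_max lexx ?orbT.
  apply: (proj2 (cP (mkpair uv))) => /=.
  by apply: (agree_cancel uv vw); apply: cE; rewrite le_max lexx ?orbT.
apply: contrapT => ni; apply: no_agree; exists G => //.
exists i => u v Gu Gv uv; apply: (cE u v uv).
rewrite leNgt; apply/negP => ic; apply: ni.
by exists (c (mkpair uv)); [exists (mkpair uv)|exact: ltW].
Qed.

End LeastWitnessColoring.

Lemma Pkappa_card (K X : Type) (x : Pkappa K X) : val x #< [set: K].
Proof. by have := valP x; rewrite inE. Qed.

Lemma le_PkappaE (K X : Type) (x y : Pkappa K X) :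
  (x <= y) = (val x `<=` val y) :> Prop.
Proof. by rewrite -subsetEset. Qed.

Lemma cofinal_Pkappa (K X : Type) (G : set (Pkappa K X)) (z : set X) :
  cofinal G -> z #< [set: K] -> exists2 y, G y & z `<=` val y.
Proof.
move=> cofG zK; have [y Gy] := cofG (exist _ z (mem_set zK)).
by rewrite le_PkappaE => zy; exists y.
Qed.

Lemma cofinal_fiber dL (L : orderType dL) dT (T : orderType dT) (f : L -> T) :
  lt_cof [set: T] L -> exists j, cofinal (f @^-1` [set j]).
Proof.
move=> TL; apply: contrapT => nj.
have /choice[u uP] : forall j, exists u, forall a, f a = j -> a < u.
  move=> j; apply: contrapT => nu; apply: nj; exists j => v.
  apply: contrapT => ny; apply: nu; exists v => a fa.
  by rewrite ltNge; apply/negP => va; apply: ny; exists a.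
have [v vP] := lt_cof_bound u TL.
by have := lt_trans (uP _ v erefl) (vP (f v) I); rewrite ltxx.
Qed.

Section Traces.
Context dT (T : orderType dT) dL (L : orderType dL) (D : T -> L -> set L).

Definition trace (x : set L) (b : L) (j : T) : set L := D j b `&` x.

Definition trace_stable (x : set L) (b : L) : Prop :=
  x `<=` [set a | a < b] /\
  forall g, b <= g -> eventually_eq (trace x b) (trace x g).

Hypotheses (covD : covering_matrix D).

Lemma trace_eventually_increasing x :
  transitive_matrix D -> (forall b : L, exists g, b < g) ->
  eventually_increasing (trace x).
Proof.
move=> trD nomaxL b g.
have [D_homo Dcup _] := covD.
rewrite le_eqVlt => /orP[/eqP <-|bg].
  have [g' bg'] := nomaxL b.
  have [i _ _] : (\bigcup_i D i g') b by rewrite Dcup.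
  by exists i => j _ a.
have [i _ Dib] : (\bigcup_i D i g) b by rewrite Dcup.
by exists i => j ij; apply: setSI; apply: trD => //; exact: D_homo Dib.
Qed.

Lemma trace_club_uniform x :
  transitive_matrix D -> uniform_matrix D -> club_uniform (trace x).
Proof.
move=> trD unifD delta /unifD[i [C clubC CD]]; exists i, C => // g Cg j ij.
have [D_homo _ _] := covD; have [Cde _ _] := clubC.
by apply: setSI; apply: trD; [exact: Cde|exact: D_homo ij _ (CD _ Cg)].
Qed.

Lemma eq_trace_sub x y b b' j :
  x `<=` y -> trace y b j = trace y b' j -> trace x b j = trace x b' j.
Proof.
move=> xy /(congr1 (setI x)).
by rewrite /trace !(setIC x) -!setIA (setIidr xy).
Qed.

Lemma stable_traces_agree x y b b' :
  x `<=` y -> trace_stable x b -> trace_stable y b' ->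
  eventually_eq (trace x b) (trace x b').
Proof.
move=> xy [_ xb] [_ yb']; pose g := Order.max b b'.
have [|i xbP] := xb g; first by rewrite le_max lexx.
have [|k yb'P] := yb' g; first by rewrite le_max lexx orbT.
exists (Order.max i k) => j; rewrite ge_max => /andP[/xbP -> /yb'P].
by move=> /(eq_trace_sub xy) ->.
Qed.

Section TracesOfPkappa.
Variables (K : Type) (b : Pkappa K L -> L).

Definition traces_agree (x y : Pkappa K L) : set T :=
  [set i | forall j, i <= j -> trace (val x) (b x) j = trace (val x) (b y) j].

Lemma traces_agree_sub x y z i : x < y ->
  traces_agree y z i -> forall j, i <= j ->
  trace (val x) (b y) j = trace (val x) (b z) j.
Proof.
move=> /ltW; rewrite le_PkappaE => xy yz j /yz; exact: eq_trace_sub.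
Qed.

Lemma stable_traces_agree_on_cofinal :
  is_ordinal T ->
  (~ exists c : pairs (Pkappa K L) -> T,
       subadditive c /\ strongly_unbounded c) ->
  (forall x, trace_stable (val x) (b x)) ->
  exists2 G, cofinal G & exists i, forall x y, G x -> G y -> val x `<=` val y ->
    traces_agree x y i.
Proof.
move=> wfT no_coloring b_stable.
have [||||G cofG [i agreeG]] :=
  agree_on_cofinal (agree := traces_agree) wfT _ _ _ _ no_coloring.
- by move=> x y i j ij xy k jk; apply: xy; exact: le_trans jk.
- move=> x y /ltW; rewrite le_PkappaE => xy.
  exact: stable_traces_agree xy (b_stable x) (b_stable y).
- move=> x y z i xy yz agree_xy agree_yz j ij.
  by rewrite agree_xy // (traces_agree_sub xy agree_yz).
- move=> x y z i xy yz agree_xz agree_yz j ij.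
  by rewrite agree_xz // (traces_agree_sub xy agree_yz).
exists G => //; exists i => x y Gx Gy; rewrite -le_PkappaE le_eqVlt.
by move=> /orP[/eqP->//|]; exact: agreeG.
Qed.

Lemma traces_agree_CP (G : set (Pkappa K L)) (i : T) :
  infinite_set [set: K] -> [set: T] #< [set: K] -> lt_cof [set: T] L ->
  (forall x, val x `<=` [set a | a < b x]) -> cofinal G ->
  (forall x y, G x -> G y -> val x `<=` val y -> traces_agree x y i) ->
  CP D.
Proof.
move=> Kinf TK TL b_gt cofG agreeG; have [D_homo Dcup _] := covD.
have transfer x y j a : G x -> G y -> val x `<=` val y -> i <= j -> val x a ->
    D j (b x) a = D j (b y) a.
  move=> Gx Gy xy ij xa.
  suff DE g : D j g a = trace (val x) g j a.
    by rewrite !DE (agreeG x y Gx Gy xy j ij).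
  by apply/propext; split=> [|[]].
have /choice[X XP] : forall a : L, exists x, G x /\ val x a.
  move=> a; have a1 : [set a] #< [set: K].
    by rewrite card_ltNge; apply/negP => /card_le_finite/(_ (finite_set1 a)).
  by have [y Gy ay] := cofinal_Pkappa cofG a1; exists y; split=> //; exact: ay.
have /choice[f fP] : forall a, exists j, i <= j /\ D j (b (X a)) a.
  move=> a; have [_ /b_gt] := XP a.
  rewrite -[X in X a]/([set c | c < b (X a)]) -Dcup => -[j _ Dj].
  exists (Order.max i j); split; first by rewrite le_max lexx.
  by apply: D_homo Dj; rewrite le_max lexx orbT.
have [j cofA] := cofinal_fiber f TL.
exists (f @^-1` [set j]) => // Z ZA ZT.
have ZK : Z #< [set: K] by apply: card_le_lt_trans TK; rewrite (card_le_eql ZT).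
have [y Gy Zy] := cofinal_Pkappa cofG ZK.
exists (b y), j => a Za.
have [GX Xa] := XP a; have [] := fP a; rewrite (ZA a Za) => ij Da.
have [z Gz] := cofinal_Pkappa cofG
  (card_lt_setU Kinf (Pkappa_card (X a)) (Pkappa_card y)).
rewrite subUset => -[Xz yz].
by rewrite (transfer y z) // -?(transfer (X a) z) //; exact: Zy.
Qed.

End TracesOfPkappa.
End Traces.

Section SmallTraces.
Context dT (T : orderType dT) dL (L : orderType dL) (D : T -> L -> set L).
Hypotheses (covD : covering_matrix D) (trD : transitive_matrix D).
Hypothesis unifD : uniform_matrix D.

Lemma small_trace_stable dK (K : orderType dK) dN (N : orderType dN)
    dI (I : orderType dI) dR (R : orderType dR) (x : set L) :
  infinite_set [set: K] -> is_successor_cardinal N K ->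
  is_successor_cardinal I N -> is_successor_cardinal R I ->
  is_ordinal L -> lt_cof [set: R] L ->
  [set: T] #<= [set: K] -> x #<= [set: K] ->
  exists b, trace_stable D x b.
Proof.
move=> Kinf succN succI succR wfL RL TK xK.
have [_ /card_ltW KN _] := succN; have [_ /card_ltW NI _] := succI.
have [_ /card_ltW IR _] := succR.
have xR : x #<= [set: R].
  exact: card_le_trans xK (card_le_trans KN (card_le_trans NI IR)).
have nomaxL (b : L) : exists g, b < g.
  apply: lt_cof_nomax RL; apply: infinite_setN0.
  have Iinf := successor_infinite (successor_infinite Kinf succN) succI.
  exact: successor_infinite Iinf succR.
have incr := trace_eventually_increasing covD x trD nomaxL.
have trace_sub b j : trace D x b j `<=` x by move=> a [].
have [b0 b0_stable] := eventually_increasing_stabilizes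
  Kinf succN succI succR wfL RL TK xK
  incr (trace_club_uniform covD x trD unifD) trace_sub.
have [b1 b1P] := lt_cof_le xR RL (card_lexx x).
pose b := Order.max b0 b1; exists b; split=> [a xa|g bg].
  by rewrite /= lt_max b1P ?orbT.
apply: eventually_sub_anti; first exact: incr.
apply: (@eventually_sub_trans _ _ _ (trace D x b0)).
  by apply: b0_stable; apply: le_trans bg; rewrite le_max lexx.
by apply: incr; rewrite le_max lexx.
Qed.

Lemma small_trace_stable_below_limit dM (M : orderType dM)
    dK (K : orderType dK) (x : set L) :
  is_infinite_cardinal M -> is_cofinality T M -> is_successor_cardinal L M ->
  infinite_set [set: K] -> [set: T] #<= [set: K] -> [set: K] #< [set: M] ->
  x #<= [set: K] -> exists b, trace_stable D x b.
Proof.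
move=> [cardM Minf] cofT succL Kinf TK KM.
have [[wfL _] _ _] := succL.
have successor_below dC (C : orderType dC) :=
  limit_cardinal_successor (K := C) cardM cofT.
have [n succN] := successor_below _ _ Kinf TK KM.
have [[_ /card_ltW KN _] Ninf] := (succN, successor_infinite Kinf succN).
have TN := card_le_trans TK KN.
have [i succI] := successor_below _ _ Ninf TN (card_segment_lt n cardM).
have [[_ /card_ltW NI _] Iinf] := (succI, successor_infinite Ninf succI).
have TI := card_le_trans TN NI.
have [r succR] := successor_below _ _ Iinf TI (card_segment_lt i cardM).
apply: (small_trace_stable Kinf succN succI succR) => //.
apply: lt_cof_le (successor_lt_cof Minf succL).
exact: card_ltW (card_segment_lt r cardM).
Qed.

End SmallTraces.

Theorem theorem4p4
    (dK : Order.disp_t) (kappa : orderType dK)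
    (dM : Order.disp_t) (mu : orderType dM)
    (dT : Order.disp_t) (cf_mu : orderType dT)
    (dL : Order.disp_t) (mu_plus : orderType dL)
    (kappa_card : is_infinite_cardinal kappa)
    (mu_card : is_infinite_cardinal mu)
    (kappa_lt_mu : [set: kappa] #< [set: mu])
    (cf_muE : is_cofinality cf_mu mu)
    (mu_plusE : is_successor_cardinal mu_plus mu)
    (cf_mu_lt_kappa : [set: cf_mu] #< [set: kappa])
    (no_coloring : ~ exists c : pairs (Pkappa kappa mu_plus) -> cf_mu,
        subadditive c /\ strongly_unbounded c) :
  forall D : cf_mu -> mu_plus -> set mu_plus,
    covering_matrix D -> transitive_matrix D -> uniform_matrix D -> CP D.
Proof.
move=> D covD trD unifD.
have [_ Kinf] := kappa_card; have [_ Minf] := mu_card.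
have [[wfT _] _ _] := cf_muE.
have TK := card_ltW cf_mu_lt_kappa.
have /choice[b b_stable] (x : Pkappa kappa mu_plus) :
    exists b, trace_stable D (val x) b.
  have xK := card_ltW (Pkappa_card x).
  exact: (small_trace_stable_below_limit (K := kappa) covD trD unifD mu_card).
have [G cofG [i agreeG]] :=
  stable_traces_agree_on_cofinal wfT no_coloring b_stable.
apply: traces_agree_CP agreeG => // [|x]; last by have [] := b_stable x.
apply: lt_cof_le (successor_lt_cof Minf mu_plusE).
exact: card_le_trans TK (card_ltW kappa_lt_mu).
Qed.
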